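(* For any $\tilde y\in\mathbb R^m$, $$\|x(\tilde y)-x^*\|\le\sigma_5\|Ax(\tilde y)-b\|,$$ where $\sigma_5>0$ is a constant depending only on $L$, $\gamma$, $A$, $G$.
   Context: Let $A\in\mathbb R^{m\times n}$, $G\in\mathbb R^{l\times n}$, $b\in\mathbb R^m$, $h\in\mathbb R^l$, $P=\{x\in\mathbb R^n: Gx\preceq h\}$ (componentwise inequality), with $\{x\in P: Ax=b\}$ nonempty. Consider the problem: minimize $g(x)$ subject to $Ax=b$, $x\in P$, where $g$ is smooth and strongly convex with modulus $\gamma>0$, and $\nabla g$ is Lipschitz continuous with constant $L$. Norms are Euclidean. Define $x(y)=\arg\min_{x\in P}\{g(x)+y^T(Ax-b)\}$ for $y\in\mathbb R^m$, and $x^*=\arg\min_{x\in P,\,Ax=b}g(x)$. *)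

(* Defs.v *)
From mathcomp Require Import all_boot all_order all_algebra.
From mathcomp Require Import all_classical all_reals all_analysis.

Set Implicit Arguments.
Unset Strict Implicit.
Unset Printing Implicit Defensive.

Import Order.TTheory GRing.Theory Num.Theory.
Import numFieldNormedType.Exports.

Local Open Scope classical_set_scope.
Local Open Scope ring_scope.

(* The norm `|x| that MathComp-Analysis puts on matrices is the sup norm, so
   the Euclidean norm is defined here. The topology, hence the meaning of
   [differentiable], is the same for both. *)
Definition norm2 (R : realType) (n : nat) (x : 'cV[R]_n) : R :=
  Num.sqrt (\sum_(i < n) x i 0 ^+ 2).

Definition dotv (R : realType) (n : nat) (x y : 'cV[R]_n) : R :=
  \sum_(i < n) x i 0 * y i 0.

Definition gradient (R : realType) (n : nat) (g : 'cV[R]_n -> R)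
    (x : 'cV[R]_n) : 'cV[R]_n :=
  \col_i 'D_(delta_mx i 0) g x.

Definition strongly_convex (R : realType) (n : nat) (gamma : R)
    (g : 'cV[R]_n -> R) : Prop :=
  forall (x y : 'cV[R]_n) (t : R), 0 <= t -> t <= 1 ->
    g (t *: x + (1 - t) *: y) <=
      t * g x + (1 - t) * g y - gamma / 2 * t * (1 - t) * norm2 (x - y) ^+ 2.

Definition lipschitz_gradient (R : realType) (n : nat) (L : R)
    (g : 'cV[R]_n -> R) : Prop :=
  forall x y : 'cV[R]_n,
    norm2 (gradient g x - gradient g y) <= L * norm2 (x - y).

Definition is_minimizer (R : realType) (n : nat) (S : set 'cV[R]_n)
    (f : 'cV[R]_n -> R) (x : 'cV[R]_n) : Prop :=
  S x /\ forall z, S z -> f x <= f z.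

(* A minimizer of f over S; the default value 0 is only taken when there is
   none. Strong convexity makes the minimizers below exist and be unique. *)
Definition argmin (R : realType) (n : nat) (S : set 'cV[R]_n)
    (f : 'cV[R]_n -> R) : 'cV[R]_n :=
  xget 0 [set x | is_minimizer S f x].

Definition polyhedron (R : realType) (l n : nat) (G : 'M[R]_(l, n))
    (h : 'cV[R]_l) : set 'cV[R]_n :=
  [set x | forall i, (G *m x) i 0 <= h i 0].

Definition feasible (R : realType) (m l n : nat) (A : 'M[R]_(m, n))
    (G : 'M[R]_(l, n)) (b : 'cV[R]_m) (h : 'cV[R]_l) : set 'cV[R]_n :=
  [set x | polyhedron G h x /\ A *m x = b].

Definition lagrangian_argmin (R : realType) (m l n : nat) (A : 'M[R]_(m, n))
    (G : 'M[R]_(l, n)) (b : 'cV[R]_m) (h : 'cV[R]_l) (g : 'cV[R]_n -> R)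
    (y : 'cV[R]_m) : 'cV[R]_n :=
  argmin (polyhedron G h) (fun x => g x + dotv y (A *m x - b)).

Definition primal_solution (R : realType) (m l n : nat) (A : 'M[R]_(m, n))
    (G : 'M[R]_(l, n)) (b : 'cV[R]_m) (h : 'cV[R]_l) (g : 'cV[R]_n -> R) :
    'cV[R]_n :=
  argmin (feasible A G b h) g.

(* Main.v *)
Require Import Defs.
From mathcomp Require Import all_boot all_order all_algebra.
From mathcomp Require Import all_classical all_reals all_analysis.
From mathcomp Require Import ring lra.

(** Write [x1 = x(y)], [x2 = x*] and [d = x1 - x2]. On the affine subspace
    [A x = A x1] the Lagrangian differs from [g] by a constant, so [x1] also
    minimizes [g] over the points [x] of [P] with [A x = A x1]. The theorem is
    thus an instance of a statement about the right-hand side alone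
    ([solution_lipschitz]): the minimizer of [g] over [P] under the constraint
    [A x = b] is a Lipschitz function of [b], with a constant that depends on
    [A], [G], [L] and [gamma] only.

    The proof of that statement avoids multipliers. Suppose that [w] satisfies
    [A w = A d], that each coordinate of [G w] lies between 0 and the same
    coordinate of [G d], and that [|w| <= c |A d|]. Then [x2 + w] is feasible
    for the problem solved by [x1], and [x1 - w] for the problem solved by
    [x2]. The two first-order optimality conditions

      [<grad g x1, w - d> >= 0]   and   [<grad g x2, d - w> >= 0]

    add up to [<grad g x1 - grad g x2, d> <= <grad g x1 - grad g x2, w>]. The
    left side is at least [gamma |d|^2] by strong convexity, and the right side
    at most [L |d| c |A d|] by Cauchy-Schwarz, whence
    [|d| <= (L c / gamma) |A d|].

    The existence of [w] with a constant [c] depending on [A] and [G] only is a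
    form of Hoffman's error bound ([conformal_hoffman]). From [d] one subtracts
    vectors of the kernel of [A] whose image under [G] agrees in sign with
    [G d], each time making one more coordinate of [G d] vanish, until no such
    vector is left ([conformal_reduction]). What remains lies in one of the
    finitely many cones cut out by a sign pattern of [G x] on which the kernel
    of [A] is trivial up to the kernel of [G]; on such a cone compactness of the
    unit sphere bounds [|x|] by a multiple of [|A x|] ([orthant_lower_bound]).

    Since an argmin without minimizer takes a default value, the existence of
    both minimizers matters too: it follows from compactness of sublevel sets
    ([coercive_minimizer]). *)

Set Implicit Arguments.
Unset Strict Implicit.
Unset Printing Implicit Defensive.

Import Order.TTheory GRing.Theory Num.Theory.
Import numFieldNormedType.Exports.

Local Open Scope classical_set_scope.
Local Open Scope ring_scope.

(** * Euclidean geometry of column vectors *)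

Lemma dotvE (R : realType) n (x y : 'cV[R]_n) : dotv x y = (x^T *m y) 0 0.
Proof. by rewrite /dotv mxE; apply: eq_bigr => i _; rewrite mxE. Qed.

Lemma dotvC (R : realType) n (x y : 'cV[R]_n) : dotv x y = dotv y x.
Proof. by apply: eq_bigr => i _; rewrite mulrC. Qed.

Lemma dotvDr (R : realType) n (x y z : 'cV[R]_n) :
  dotv x (y + z) = dotv x y + dotv x z.
Proof. by rewrite !dotvE mulmxDr mxE. Qed.

Lemma dotvNr (R : realType) n (x y : 'cV[R]_n) : dotv x (- y) = - dotv x y.
Proof. by rewrite !dotvE mulmxN mxE. Qed.

Lemma dotvBr (R : realType) n (x y z : 'cV[R]_n) :
  dotv x (y - z) = dotv x y - dotv x z.
Proof. by rewrite dotvDr dotvNr. Qed.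

Lemma dotvBl (R : realType) n (x y z : 'cV[R]_n) :
  dotv (x - y) z = dotv x z - dotv y z.
Proof. by rewrite dotvC dotvBr !(dotvC z). Qed.

Lemma dotvZr (R : realType) n a (x y : 'cV[R]_n) :
  dotv x (a *: y) = a * dotv x y.
Proof. by rewrite !dotvE -scalemxAr mxE. Qed.

Lemma dotv_mulmx (R : realType) m n (A : 'M[R]_(m, n)) y x :
  dotv y (A *m x) = dotv (A^T *m y) x.
Proof. by rewrite !dotvE trmx_mul trmxK mulmxA. Qed.

Lemma norm2_ge0 (R : realType) n (x : 'cV[R]_n) : 0 <= norm2 x.
Proof. exact: sqrtr_ge0. Qed.

Lemma norm2_sqr (R : realType) n (x : 'cV[R]_n) : norm2 x ^+ 2 = dotv x x.
Proof.
rewrite /norm2 sqr_sqrtr; first by apply: eq_bigr => i _; rewrite expr2.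
by apply: sumr_ge0 => i _; exact: sqr_ge0.
Qed.

Lemma norm2_coord (R : realType) n (x : 'cV[R]_n) i : `|x i 0| <= norm2 x.
Proof.
rewrite -ler_sqr ?nnegrE ?norm2_ge0 // norm2_sqr real_normK ?num_real //.
rewrite /dotv (bigD1 i) //= -expr2 lerDl.
by apply: sumr_ge0 => j _; rewrite -expr2 sqr_ge0.
Qed.

Lemma norm2_eq0 (R : realType) n (x : 'cV[R]_n) : norm2 x = 0 -> x = 0.
Proof.
move=> x0; apply/colP => i; rewrite mxE; apply/eqP.
by rewrite -normr_le0 -x0 norm2_coord.
Qed.

Lemma norm2_gt0 (R : realType) n (x : 'cV[R]_n) : x != 0 -> 0 < norm2 x.
Proof.
by move=> x0; rewrite lt0r norm2_ge0 andbT; apply: contraNneq x0 => /norm2_eq0 ->.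
Qed.

Lemma norm2Z (R : realType) n a (x : 'cV[R]_n) :
  0 <= a -> norm2 (a *: x) = a * norm2 x.
Proof.
move=> a0; apply: (@pexpIrn _ 2) => //; rewrite ?nnegrE ?mulr_ge0 ?norm2_ge0 //.
by rewrite exprMn !norm2_sqr dotvZr dotvC dotvZr mulrA expr2.
Qed.

Lemma norm20 (R : realType) n : norm2 (0 : 'cV[R]_n) = 0.
Proof. by rewrite -[X in norm2 X](scale0r 0) norm2Z // mul0r. Qed.

Lemma norm2N (R : realType) n (x : 'cV[R]_n) : norm2 (- x) = norm2 x.
Proof. by rewrite /norm2; congr Num.sqrt; apply: eq_bigr => i _; rewrite mxE sqrrN. Qed.

Lemma dotv_le_norm2 (R : realType) n (x y : 'cV[R]_n) :
  dotv x y <= norm2 x * norm2 y.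
Proof.
have [->|x0] := eqVneq x 0.
  by rewrite dotvC -[X in dotv _ X](scale0r 0) dotvZr mul0r mulr_ge0 ?norm2_ge0.
have [->|y0] := eqVneq y 0.
  by rewrite -[X in dotv _ X](scale0r 0) dotvZr mul0r mulr_ge0 ?norm2_ge0.
set a := norm2 x; set b := norm2 y.
have ab : 0 < a * b by rewrite mulr_gt0 ?norm2_gt0.
have := sqr_ge0 (norm2 (b *: x - a *: y)); rewrite norm2_sqr.
rewrite dotvBr 2!dotvBl !dotvZr !(dotvC (_ *: _)) !dotvZr -!norm2_sqr -/a -/b (dotvC y x).
move=> H; rewrite -(ler_pM2l ab); lra.
Qed.

Lemma norm2D (R : realType) n (x y : 'cV[R]_n) :
  norm2 (x + y) <= norm2 x + norm2 y.
Proof.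
rewrite -ler_sqr ?nnegrE ?addr_ge0 ?norm2_ge0 // norm2_sqr dotvDr.
rewrite ![dotv (x + y) _]dotvC !dotvDr (dotvC y x) -!norm2_sqr.
have := dotv_le_norm2 x y; nra.
Qed.

(** * Continuity and compactness *)

Lemma sum_continuous (T : topologicalType) (R : realType) n (f : 'I_n -> T -> R) :
  (forall i, continuous (f i)) -> continuous (fun x => \sum_(i < n) f i x).
Proof.
move=> cf; apply: continuous_big => //; exact: add_continuous.
Qed.

Lemma coord_mulmx_continuous (R : realType) m n (M : 'M[R]_(m, n)) i :
  continuous (fun x : 'cV[R]_n => (M *m x) i 0).
Proof.
rewrite (_ : (fun x => _) = fun x : 'cV[R]_n => \sum_(j < n) M i j * x j 0); last first.
  by apply/funext => x; rewrite mxE.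
apply: sum_continuous => j x.
apply: (@continuousM _ _ (fun=> M i j) (fun y : 'cV[R]_n => y j 0)).
  exact: cst_continuous.
exact: coord_continuous.
Qed.

Lemma norm2_mulmx_continuous (R : realType) m n (M : 'M[R]_(m, n)) :
  continuous (fun x : 'cV[R]_n => norm2 (M *m x)).
Proof.
move=> x; apply: (@continuous_comp _ _ _ _ (@Num.sqrt R)); last exact: sqrt_continuous.
apply: sum_continuous => i {}x.
apply: (@continuousM _ _ (fun y => (M *m y) i 0) (fun y => (M *m y) i 0));
  exact: coord_mulmx_continuous.
Qed.

Lemma norm2_continuous (R : realType) n : continuous (@norm2 R n).
Proof.
rewrite (_ : @norm2 R n = fun x => norm2 (1%:M *m x)).
  exact: norm2_mulmx_continuous.
by apply/funext => x; rewrite mul1mx.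
Qed.

Lemma trmx_continuous (R : realType) m n :
  continuous (trmx : 'M[R]_(m, n) -> 'M[R]_(n, m)).
Proof.
move=> x A [P Px sPA]; exists (fun i j => P j i).
  by move=> i j; have := Px j i; rewrite mxE.
by move=> y /= Py; apply: sPA => i j /=; rewrite mxE.
Qed.

(** Transposition carries the problem to row vectors, where closed bounded sets
    are compact by the Heine-Borel theorem. *)
Lemma exists_minimizer (R : realType) n (S : set 'cV[R]_n) (f : 'cV[R]_n -> R)
    (r : R) :
  S !=set0 -> closed S -> (forall x, S x -> norm2 x <= r) -> continuous f ->
  exists x, is_minimizer S f x.
Proof.
move=> [x0 Sx0] clS bS cf.
pose T := [set u : 'rV[R]_n | S u^T].
have [|||c cT cmin] := @EVT_min_rV R n (fun u => f u^T) T.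
- by exists x0^T; rewrite /T /= trmxK.
- apply: bounded_closed_compact.
    exists r; split; first exact: num_real.
    move=> q rq u /bS ur; rewrite /Num.Def.normr /= mx_normrE.
    apply/bigmax_leP; split=> [|[i j] _ /=].
      by rewrite (le_trans _ (ltW rq)) // (le_trans _ ur) ?norm2_ge0.
    rewrite (le_trans _ (ltW rq)) // (le_trans _ ur) // ord1.
    by have := norm2_coord u^T j; rewrite mxE.
  by apply: closed_comp => // u _; exact: trmx_continuous.
- apply: continuous_subspaceT => u.
  by apply: continuous_comp; [exact: trmx_continuous | exact: cf].
exists c^T; split; first by rewrite inE in cT.
by move=> z Sz; have := cmin z^T; rewrite trmxK; apply; rewrite inE /T /= trmxK.
Qed.

(** * A Hoffman-type error bound *)

(** By homogeneity it suffices to bound [norm2 (A *m x)] from below on the unit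
    vectors of [K], where a continuous positive function attains its minimum. *)
Lemma norm2_mulmx_lower_bound (R : realType) m n (A : 'M[R]_(m, n))
    (K : set 'cV[R]_n) :
  closed K -> (forall a x, 0 <= a -> K x -> K (a *: x)) ->
  (forall x, K x -> A *m x = 0 -> x = 0) ->
  exists2 c, 0 <= c & forall x, K x -> norm2 x <= c * norm2 (A *m x).
Proof.
move=> clK coneK kerK.
pose S := K `&` [set x | norm2 x = 1].
have unitS x : K x -> x != 0 -> S ((norm2 x)^-1 *: x).
  move=> Kx x0; have px := norm2_gt0 x0.
  split; first by apply: coneK Kx; rewrite invr_ge0 ltW.
  by rewrite /= norm2Z ?invr_ge0 ?ltW // mulVf // gt_eqF.
have [S0|] := pselect (S !=set0); last first.
  move=> noS; exists 1 => // x Kx.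
  have [->|x0] := eqVneq x 0; first by rewrite mulmx0 !norm20 mul1r.
  by case: noS; exists ((norm2 x)^-1 *: x); exact: unitS.
have clS : closed S.
  apply: closedI => //; apply: (@closed_comp _ _ (@norm2 R n) [set 1]).
    by move=> x _; exact: norm2_continuous.
  exact: closed_eq.
have bS x : S x -> norm2 x <= 1 by case=> _ ->.
have [u [[Ku u1] umin]] :=
  exists_minimizer S0 clS bS (@norm2_mulmx_continuous R m n A).
have Au : 0 < norm2 (A *m u).
  apply: norm2_gt0; apply/eqP => /(kerK u Ku) u0.
  by have := @oner_neq0 R; rewrite -u1 u0 norm20 eqxx.
exists (norm2 (A *m u))^-1; first by rewrite invr_ge0 ltW.
move=> x Kx; have [->|x0] := eqVneq x 0.
  by rewrite mulmx0 !norm20 mulr0.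
have := umin _ (unitS x Kx x0).
rewrite -scalemxAr norm2Z ?invr_ge0 ?norm2_ge0 // mulrC.
by rewrite ler_pdivlMr ?norm2_gt0 // mulrC -ler_pdivlMr // mulrC.
Qed.

Definition between (R : realType) l (p q : 'cV[R]_l) : Prop :=
  forall i, Num.min 0 (q i 0) <= p i 0 <= Num.max 0 (q i 0).

(** A sign pattern is the pair of the sets of indices where positive and negative
    values are allowed. A coordinate whose index is in neither set must vanish,
    so that a pattern also records a support; weak inequalities make the cone
    closed. *)
Definition orthant (R : realType) l (PN : {set 'I_l} * {set 'I_l}) :
    set 'cV[R]_l :=
  [set q | forall i, (i \notin PN.2 -> 0 <= q i 0) /\
                     (i \notin PN.1 -> q i 0 <= 0)].

Definition signs (R : realType) l (q : 'cV[R]_l) : {set 'I_l} * {set 'I_l} :=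
  ([set i | 0 < q i 0], [set i | q i 0 < 0])%SET.

Lemma orthant_signs (R : realType) l (q : 'cV[R]_l) : orthant (signs q) q.
Proof. by move=> i; rewrite !inE -!leNgt. Qed.

Lemma between_refl (R : realType) l (q : 'cV[R]_l) : between q q.
Proof. by move=> i; rewrite ge_min le_max lexx !orbT. Qed.

Lemma between_trans (R : realType) l (q p r : 'cV[R]_l) :
  between p q -> between q r -> between p r.
Proof.
move=> pq qr i; have /andP[a b] := pq i; have /andP[c d] := qr i.
apply/andP; split.
  by apply: le_trans a; rewrite le_min ge_min lexx.
by apply: le_trans b _; rewrite ge_max le_max lexx.
Qed.

Lemma orthant_closed (R : realType) l n (G : 'M[R]_(l, n)) PN :
  closed [set x | orthant PN (G *m x)].
Proof.
pose H (b : bool) i : set 'cV[R]_n :=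
  if b then [set x | i \notin PN.2 -> 0 <= (G *m x) i 0]
  else [set x | i \notin PN.1 -> (G *m x) i 0 <= 0].
rewrite (_ : mkset _ = \bigcap_i (H true i `&` H false i)); last first.
  by apply/seteqP; split=> x /= Hx i *; [have := Hx i | have := Hx i I].
have cG i := @coord_mulmx_continuous R l n G i.
apply: closed_bigI => i _; rewrite /H; apply: closedI.
  case: (boolP (i \notin PN.2)) => _.
    rewrite (_ : mkset _ = (fun x : 'cV_n => (G *m x) i 0) @^-1` [set y | 0 <= y]).
      by apply: closed_comp; [move=> x _; exact: cG | exact: closed_ge].
    by apply/seteqP; split=> x /=; [apply|].
  rewrite (_ : mkset _ = setT); first exact: closedT.
  by apply/seteqP; split.
case: (boolP (i \notin PN.1)) => _.
  rewrite (_ : mkset _ = (fun x : 'cV_n => (G *m x) i 0) @^-1` [set y | y <= 0]).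
    by apply: closed_comp; [move=> x _; exact: cG | exact: closed_le].
  by apply/seteqP; split=> x /=; [apply|].
rewrite (_ : mkset _ = setT); first exact: closedT.
by apply/seteqP; split.
Qed.

(** Moving from [q] against [p], no coordinate grows in absolute value as long
    as none changes sign; the coordinate with the least ratio [q i / p i] is the
    first to vanish. *)
Lemma conformal_step (R : realType) l (p q : 'cV[R]_l) :
  orthant (signs q) p -> p != 0 ->
  exists t, between (q - t *: p) q /\
    [pred i | (q - t *: p) i 0 != 0] \proper [pred i | q i 0 != 0].
Proof.
move=> pq p0.
have pq0 i : p i 0 != 0 -> 0 < q i 0 / p i 0.
  move=> pi0; have [] := pq i; rewrite !inE -!leNgt.
  case: (ltrgtP (q i 0) 0) => qi.
  - move=> _ /(_ isT) pn; rewrite -mulrNN -invrN divr_gt0 //; lra.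
  - by move=> /(_ isT) pp _; rewrite divr_gt0 // lt0r pi0.
  - by move=> /(_ isT) a /(_ isT) b; case/eqP: pi0; lra.
have [i0 pi0] : exists i, p i 0 != 0.
  apply: contrapT => noi; case/eqP: p0; apply/colP => i; rewrite mxE.
  by apply/eqP; apply: contra_notT noi => pi; exists i.
have [k pk kmin] := arg_minP (fun i => q i 0 / p i 0) (pi0 : [pred i | p i 0 != 0] i0).
set t := q k 0 / p k 0; have t0 : 0 < t := pq0 k pk; exists t.
split=> [i|].
  rewrite !mxE; have [->|pi] := eqVneq (p i 0) 0.
    by rewrite mulr0 subr0 ge_min le_max lexx !orbT.
  have := kmin i pi; rewrite -/t; set r := q i 0 / p i 0 => tr.
  have -> : q i 0 = r * p i 0 by rewrite /r divfK.
  rewrite -mulrBl ge_min le_max; case: (ltrgtP (p i 0) 0) pi => // pi _.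
    by apply/andP; split; apply/orP; [right|left]; nra.
  by apply/andP; split; apply/orP; [left|right]; nra.
apply/properP; split.
  apply/fintype.subsetP => i; rewrite !inE !mxE; apply: contraNneq => qi.
  have [->|/pq0] := eqVneq (p i 0) 0; first by rewrite qi mulr0 subr0.
  by rewrite qi mul0r ltxx.
exists k; rewrite !inE.
  by apply: contraTneq t0 => qk; rewrite /t qk mul0r ltxx.
by rewrite negbK !mxE divfK // subrr.
Qed.

(** A sign pattern to which [conformal_step] can no longer be applied with a
    direction from the kernel of [A]. *)
Definition no_kernel (R : realType) m l n (A : 'M[R]_(m, n)) (G : 'M[R]_(l, n)) PN :=
  forall u, orthant PN (G *m u) -> A *m u = 0 -> G *m u = 0.

(** Each [conformal_step] along a kernel vector keeps [A *m v], shrinks [G *m v]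
    towards 0 and shortens its support, so the process stops. *)
Lemma conformal_reduction (R : realType) m l n (A : 'M[R]_(m, n))
    (G : 'M[R]_(l, n)) (v : 'cV[R]_n) :
  exists w, [/\ A *m w = A *m v, between (G *m w) (G *m v) &
    no_kernel A G (signs (G *m w))].
Proof.
have [k] := ubnP #|[pred i | (G *m v) i 0 != 0]|.
elim: k v => // k IH v vk.
have [irr|] := pselect (no_kernel A G (signs (G *m v))).
  by exists v; split => //; exact: between_refl.
move=> /existsNP[u /not_implyP[Gu /not_implyP[Au /eqP Gu0]]].
have [t [btw lt]] := conformal_step Gu Gu0.
have [|w [Aw Gw Kw]] := IH (v - t *: u).
  by rewrite mulmxBr -scalemxAr (leq_trans (proper_card lt)).
exists w; split => //.
  by rewrite Aw mulmxBr -scalemxAr Au scaler0 subr0.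
by apply: between_trans Gw _; rewrite mulmxBr -scalemxAr.
Qed.

(** The cone of the [x] with [orthant PN (G *m x)] contains the common kernel of
    [A] and [G], where [A *m x] vanishes but [x] need not. Replacing [v] by a
    representative [w] in a complement of that common kernel removes this
    obstruction and changes neither [A *m v] nor [G *m v]. *)
Lemma orthant_lower_bound (R : realType) m l n (A : 'M[R]_(m, n))
    (G : 'M[R]_(l, n)) PN :
  no_kernel A G PN ->
  exists2 c, 0 <= c & forall v, orthant PN (G *m v) ->
    exists w, [/\ A *m w = A *m v, G *m w = G *m v &
      norm2 w <= c * norm2 (A *m v)].
Proof.
move=> irr.
(* B is a projector with the same kernel as M, i.e. along the common kernel of
   A and G. *)
pose M := col_mx A G; pose B := pinvmx M *m M.
have MB : M *m B = M by rewrite mulmxA mulmxKpV.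
have [AB GB] : A *m B = A /\ G *m B = G.
  by apply: eq_col_mx; rewrite -mul_col_mx.
have BB : B *m B = B by rewrite {1}/B -mulmxA MB.
have B0 x : A *m x = 0 -> G *m x = 0 -> B *m x = 0.
  by move=> Ax Gx; rewrite /B -mulmxA mul_col_mx Ax Gx col_mx0 mulmx0.
clearbody B.
pose K := [set x | orthant PN (G *m x)] `&` [set x | B *m x = x].
have [|||c c0 Kc] := @norm2_mulmx_lower_bound R m n A K.
- apply: closedI; first exact: orthant_closed.
  rewrite (_ : mkset _ = \bigcap_i
      ((fun x : 'cV_n => ((B - 1%:M) *m x) i 0) @^-1` [set 0])).
    apply: closed_bigI => i _; apply: closed_comp; last exact: closed_eq.
    by move=> x _; exact: coord_mulmx_continuous.
  apply/seteqP; split=> x /=.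
    by move=> Bx i _; rewrite /= mulmxBl Bx mul1mx subrr mxE.
  move=> Bx; apply/eqP; rewrite -subr_eq0 -[X in _ - X]mul1mx -mulmxBl.
  by apply/eqP/colP => i; rewrite [RHS]mxE; exact: (Bx i I).
- move=> a x a0 [Kx Bx]; split; last by rewrite /= -scalemxAr Bx.
  move=> i; have [Ki1 Ki2] := Kx i; rewrite -scalemxAr mxE.
  by split=> [/Ki1|/Ki2] ?; rewrite ?mulr_ge0 ?mulr_ge0_le0.
- move=> x [Kx Bx] Ax; by rewrite -Bx B0 // irr.
exists c => // v Kv; exists (B *m v).
rewrite !mulmxA AB GB; split => //.
rewrite -[in leRHS]AB -mulmxA; apply: Kc; split; last by rewrite /= mulmxA BB.
by rewrite /= mulmxA GB.
Qed.

(** There are finitely many sign patterns, hence the constants given by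
    [orthant_lower_bound] for those without kernel have a common bound; their
    sum is one. *)
Lemma conformal_hoffman (R : realType) m l n (A : 'M[R]_(m, n))
    (G : 'M[R]_(l, n)) :
  exists2 c, 0 <= c & forall v, exists w,
    [/\ A *m w = A *m v, between (G *m w) (G *m v) &
        norm2 w <= c * norm2 (A *m v)].
Proof.
have /fin_all_exists2[c c0 cP] PN : exists2 c, 0 <= c & no_kernel A G PN ->
    forall v, orthant PN (G *m v) -> exists w,
    [/\ A *m w = A *m v, G *m w = G *m v & norm2 w <= c * norm2 (A *m v)].
  have [irr|red] := pselect (no_kernel A G PN); last by exists 0.
  by have [c c0 cP] := orthant_lower_bound irr; exists c.
exists (\sum_PN c PN); first by apply: sumr_ge0.
move=> v; have [w [Aw Gw irr]] := conformal_reduction A G v.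
have [x [Ax Gx xw]] := cP _ irr w (orthant_signs _).
exists x; rewrite Ax Aw Gx; split => //.
rewrite (le_trans xw) // Aw ler_wpM2r ?norm2_ge0 //.
by rewrite (bigD1 (signs (G *m w))) //= lerDl sumr_ge0.
Qed.

(** * First-order conditions for strongly convex functions *)

Lemma derive_gradient (R : realType) n (g : 'cV[R]_n -> R) (x v : 'cV[R]_n) :
  differentiable g x -> 'D_v g x = dotv (gradient g x) v.
Proof.
move=> dg; rewrite deriveE // {1}[v]matrix_sum_delta linear_sum.
apply: eq_bigr => i _; rewrite big_ord1 linearZ /= mxE deriveE //.
exact: mulrC.
Qed.

Lemma derive_cvg_right (R : realType) n (g : 'cV[R]_n -> R) (x v : 'cV[R]_n) :
  differentiable g x ->
  t^-1 * (g (x + t *: v) - g x) @[t --> 0^'+] --> 'D_v g x.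
Proof.
move=> dg; apply: cvg_dnbhs_at_right.
have := @diff_derivable _ _ _ g x v dg; rewrite /derivable /derive.
rewrite (_ : (fun h : R => _) = fun t : R => t^-1 * (g (x + t *: v) - g x)) //.
by apply/funext => t; rewrite [x + _]addrC.
Qed.

Lemma first_order_optimality (R : realType) n (g : 'cV[R]_n -> R) (x v : 'cV[R]_n) :
  differentiable g x ->
  (forall t, 0 < t -> t <= 1 -> g x <= g (x + t *: v)) ->
  0 <= dotv (gradient g x) v.
Proof.
move=> dg opt; rewrite -derive_gradient //.
apply: (ler_cvg_to (cvg_cst 0) (derive_cvg_right dg)).
near=> t.
have t0 : 0 < t by near: t; exact: nbhs_right_gt.
rewrite mulr_ge0 ?invr_ge0 ?(ltW t0) // subr_ge0 opt //.
by near: t; exact: nbhs_right_le.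
Unshelve. all: by end_near. Qed.

(** Strong convexity along the segment from [x] to [z], divided by the parameter
    [t], bounds the difference quotient by
    [g z - g x - (1 - t) * gamma / 2 * norm2 (z - x) ^+ 2]; then [t] tends to 0. *)
Lemma strongly_convex_tangent (R : realType) n gamma (g : 'cV[R]_n -> R)
    (x z : 'cV[R]_n) :
  strongly_convex gamma g -> differentiable g x ->
  g x + dotv (gradient g x) (z - x) + gamma / 2 * norm2 (z - x) ^+ 2 <= g z.
Proof.
move=> sc dg; rewrite -derive_gradient //.
set N := norm2 (z - x) ^+ 2; set k := gamma / 2 * N.
suff: 'D_(z - x) g x <= g z - g x - k by lra.
have : g z - g x - k + t * k @[t --> 0^'+] --> g z - g x - k + 0 * k.
  apply: cvgD; first exact: cvg_cst.
  apply: cvgM; last exact: cvg_cst.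
  exact: cvg_at_right_filter.
rewrite mul0r addr0 => cvg_bound.
apply: (ler_cvg_to (derive_cvg_right dg) cvg_bound).
near=> t.
have t0 : 0 < t by near: t; exact: nbhs_right_gt.
have t1 : t <= 1 by near: t; exact: nbhs_right_le.
rewrite mulrC ler_pdivrMr //.
have := sc z x t (ltW t0) t1; rewrite -/N.
rewrite (_ : t *: z + (1 - t) *: x = x + t *: (z - x)); last first.
  by rewrite scalerBl scale1r scalerBr addrCA.
rewrite /k; lra.
Unshelve. all: by end_near. Qed.

Lemma strongly_monotone_gradient (R : realType) n gamma (g : 'cV[R]_n -> R)
    (x z : 'cV[R]_n) :
  strongly_convex gamma g -> differentiable g x -> differentiable g z ->
  gamma * norm2 (x - z) ^+ 2 <=
    dotv (gradient g x - gradient g z) (x - z).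
Proof.
move=> sc dx dz.
have := strongly_convex_tangent z sc dx; have := strongly_convex_tangent x sc dz.
rewrite -[z - x]opprB norm2N dotvNr dotvBl; lra.
Qed.

(** The lower bound forces [norm2 (z - x0) <= 2 / gamma * norm2 p] wherever
    [f z <= f x0], so that only a compact part of [S] matters. *)
Lemma coercive_minimizer (R : realType) n gamma (S : set 'cV[R]_n)
    (f : 'cV[R]_n -> R) (x0 p : 'cV[R]_n) :
  0 < gamma -> S x0 -> closed S -> continuous f ->
  (forall z, f x0 + dotv p (z - x0) + gamma / 2 * norm2 (z - x0) ^+ 2 <= f z) ->
  exists x, is_minimizer S f x.
Proof.
move=> g0 Sx0 clS cf low.
pose r := 2 / gamma * norm2 p; pose T := S `&` [set z | f z <= f x0].
have low_r z : f z <= f x0 -> norm2 (z - x0) <= r.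
  have [->|zx] := eqVneq z x0.
    by rewrite subrr norm20 mulr_ge0 ?norm2_ge0 // divr_ge0 // ltW.
  have zx0 : 0 < norm2 (z - x0) by rewrite norm2_gt0 // subr_eq0.
  move=> fz; have := low z; have := dotv_le_norm2 (- p) (z - x0).
  rewrite norm2N dotvC dotvNr dotvC => cs lz.
  rewrite /r mulrAC ler_pdivlMr // -(ler_pM2r zx0); nra.
have [x [[Sx fx] xmin]] : exists x, is_minimizer T f x.
  apply: (@exists_minimizer R n T f (r + norm2 x0)) => //.
  - by exists x0; split => /=.
  - apply: closedI => //; apply: (@closed_comp _ _ f [set y | y <= f x0]).
      by move=> z _; exact: cf.
    exact: closed_le.
  - move=> z [_ /low_r zr]; rewrite -[z](subrK x0).
    by apply: le_trans (norm2D _ _) _; rewrite lerD2r.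
exists x; split => // z Sz; have [fz|/ltW fz] := leP (f z) (f x0).
  exact: xmin.
exact: le_trans fx fz.
Qed.

(** * Constrained minimizers *)

Lemma argmin_minimizer (R : realType) n (S : set 'cV[R]_n) (f : 'cV[R]_n -> R) :
  (exists x, is_minimizer S f x) -> is_minimizer S f (argmin S f).
Proof. by move=> [x Sx]; rewrite /argmin; case: xgetP => [y _ //|/(_ x)]. Qed.

Lemma polyhedron_closed (R : realType) l n (G : 'M[R]_(l, n)) h :
  closed (polyhedron G h).
Proof.
rewrite (_ : polyhedron G h = \bigcap_i
    ((fun x : 'cV_n => (G *m x) i 0) @^-1` [set y | y <= h i 0])).
  apply: closed_bigI => i _; apply: closed_comp; last exact: closed_le.
  by move=> x _; exact: coord_mulmx_continuous.
by apply/seteqP; split=> x Hx i *; [exact: Hx | exact: (Hx i I)].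
Qed.

Lemma feasible_closed (R : realType) m l n (A : 'M[R]_(m, n))
    (G : 'M[R]_(l, n)) b h :
  closed (feasible A G b h).
Proof.
rewrite (_ : feasible A G b h = polyhedron G h `&` \bigcap_i
    ((fun x : 'cV_n => (A *m x) i 0) @^-1` [set b i 0])).
  apply: closedI; first exact: polyhedron_closed.
  apply: closed_bigI => i _; apply: closed_comp; last exact: closed_eq.
  by move=> x _; exact: coord_mulmx_continuous.
apply/seteqP; split=> x [Px Ax]; split=> //; first by move=> i _ /=; rewrite Ax.
by apply/colP => i; exact: (Ax i I).
Qed.

Lemma polyhedron_convex (R : realType) l n (G : 'M[R]_(l, n)) h x z t :
  polyhedron G h x -> polyhedron G h z -> 0 <= t -> t <= 1 ->
  polyhedron G h (x + t *: (z - x)).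
Proof.
move=> Px Pz t0 t1 i; have := Px i; have := Pz i.
rewrite mulmxDr -scalemxAr mulmxBr !mxE; nra.
Qed.

Lemma feasible_first_order (R : realType) m l n (A : 'M[R]_(m, n))
    (G : 'M[R]_(l, n)) b h (g : 'cV[R]_n -> R)
    (x z : 'cV[R]_n) :
  differentiable g x -> is_minimizer (feasible A G b h) g x ->
  feasible A G b h z -> 0 <= dotv (gradient g x) (z - x).
Proof.
move=> dg [[Px Ax] xmin] [Pz Az]; apply: first_order_optimality => // t t0 t1.
apply: xmin; split; first by apply: polyhedron_convex => //; exact: ltW.
by rewrite mulmxDr -scalemxAr mulmxBr Ax Az subrr scaler0 addr0.
Qed.

(** The penalty [dotv y (A *m z - b)] is constant on the points [z] with the
    same image under [A] as [x]. *)
Lemma lagrangian_minimizer (R : realType) m l n (A : 'M[R]_(m, n))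
    (G : 'M[R]_(l, n)) b h (g : 'cV[R]_n -> R) y x :
  is_minimizer (polyhedron G h) (fun z => g z + dotv y (A *m z - b)) x ->
  is_minimizer (feasible A G (A *m x) h) g x.
Proof.
move=> [Px xmin]; split => // z [Pz Az].
by have := xmin z Pz; rewrite Az lerD2r.
Qed.

(** The exchange argument: a short vector [w] with [A *m w = b1 - b2] and
    [G *m w] between 0 and [G *m (x1 - x2)] carries [x2] to a feasible point of
    the first problem and [x1] to one of the second. *)
Lemma solution_lipschitz (R : realType) m l n (A : 'M[R]_(m, n))
    (G : 'M[R]_(l, n)) (L gamma : R) :
  0 < gamma ->
  exists2 sigma : R, 0 < sigma & forall b1 b2 h (g : 'cV[R]_n -> R) x1 x2,
    (forall x, differentiable g x) ->
    strongly_convex gamma g -> lipschitz_gradient L g ->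
    is_minimizer (feasible A G b1 h) g x1 ->
    is_minimizer (feasible A G b2 h) g x2 ->
    norm2 (x1 - x2) <= sigma * norm2 (b1 - b2).
Proof.
move=> gamma0; have [c c0 hoffman] := conformal_hoffman A G.
(* The summand 1 only ensures positivity, and the absolute value spares the
   case of a negative L. *)
exists (`|L| * c / gamma + 1).
  by rewrite ltr_wpDl // divr_ge0 ?mulr_ge0 // ltW.
move=> b1 b2 h g x1 x2 dg sc lip min1 min2.
have [[P1 A1] _] := min1; have [[P2 A2] _] := min2.
have [w [Aw Gw wc]] := hoffman (x1 - x2).
have {Aw} Aw : A *m w = b1 - b2 by rewrite Aw mulmxBr A1 A2.
rewrite mulmxBr A1 A2 in wc.
(* Both points satisfy the inequalities because each coordinate of G w lies
   between 0 and that of G x1 - G x2: both images lie in the box spanned by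
   G x1 and G x2. *)
have F1 : feasible A G b1 h (x2 + w).
  split; last by rewrite mulmxDr A2 Aw addrC subrK.
  move=> i; move: (Gw i) (P1 i) (P2 i); rewrite mulmxBr mulmxDr.
  move: (G *m x1) (G *m x2) (G *m w) => p1 p2 q; rewrite !mxE.
  by move=> /andP[_]; rewrite le_max => /orP[]; lra.
have F2 : feasible A G b2 h (x1 - w).
  split; last by rewrite mulmxBr A1 Aw opprB addrC subrK.
  move=> i; move: (Gw i) (P1 i) (P2 i); rewrite !mulmxBr.
  move: (G *m x1) (G *m x2) (G *m w) => p1 p2 q; rewrite !mxE.
  by move=> /andP[+ _]; rewrite ge_min => /orP[]; lra.
have opt1 := feasible_first_order (dg x1) min1 F1.
have opt2 := feasible_first_order (dg x2) min2 F2.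
have mono := strongly_monotone_gradient sc (dg x1) (dg x2).
set d := x1 - x2 in mono *; set dG := gradient g x1 - gradient g x2 in mono.
have dw : dotv dG d <= dotv dG w.
  rewrite -subr_ge0 -dotvBr dotvBl.
  have -> : w - d = x2 + w - x1 by rewrite /d opprB addrA (addrC w).
  have -> : dotv (gradient g x2) (x2 + w - x1) = - dotv (gradient g x2) (x1 - w - x2).
    by rewrite -dotvNr; congr dotv; rewrite !opprB addrA (addrC x2).
  by rewrite opprK addr_ge0.
have lipd : norm2 dG <= `|L| * norm2 d.
  by rewrite (le_trans (lip _ _)) // ler_wpM2r ?norm2_ge0 ?ler_norm.
have [->|d0] := eqVneq d 0.
  rewrite norm20 mulr_ge0 ?norm2_ge0 // addr_ge0 //.
  by rewrite divr_ge0 ?mulr_ge0 // ltW.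
have key : gamma * norm2 d <= `|L| * c * norm2 (b1 - b2).
  have nd := norm2_gt0 d0; rewrite -(ler_pM2r nd).
  have cs := dotv_le_norm2 dG w.
  have step1 := ler_wpM2r (norm2_ge0 w) lipd.
  have step2 := ler_wpM2l (mulr_ge0 (normr_ge0 L) (norm2_ge0 d)) wc.
  lra.
rewrite mulrDl mul1r ler_wpDr ?norm2_ge0 //.
by rewrite mulrAC ler_pdivlMr // mulrC.
Qed.

(** The tangent inequality of [g] at a feasible point gives the quadratic lower
    bound that [coercive_minimizer] asks for; the affine term of the Lagrangian
    only adds [A^T *m y] to the slope. *)
Lemma argmins_minimize (R : realType) (m l n : nat)
  (A : 'M[R]_(m, n)) (G : 'M[R]_(l, n)) (gamma : R) b h (g : 'cV[R]_n -> R) y :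
  0 < gamma -> feasible A G b h !=set0 ->
  (forall x : 'cV[R]_n, differentiable g x) ->
  strongly_convex gamma g ->
  is_minimizer (polyhedron G h) (fun z => g z + dotv y (A *m z - b))
    (lagrangian_argmin A G b h g y) /\
  is_minimizer (feasible A G b h) g (primal_solution A G b h g).
Proof.
move=> gamma0 [x0 Fx0] dg sc.
have cg : continuous g by move=> x; exact: differentiable_continuous.
have tangent z := strongly_convex_tangent z sc (dg x0).
split; apply: argmin_minimizer; last first.
  exact: coercive_minimizer gamma0 Fx0 (@feasible_closed _ _ _ _ _ _ _ _) cg tangent.
have [Px0 _] := Fx0.
apply: (@coercive_minimizer _ _ _ _ _ x0 (gradient g x0 + A^T *m y) gamma0) => //.
- exact: polyhedron_closed.
- rewrite (_ : (fun z => _) =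
      (fun z : 'cV_n => g z + ((y^T *m A *m z) 0 0 - dotv y b))).
    move=> x; apply: (@continuousD _ _ _ g); first exact: cg.
    apply: (@continuousB _ _ _ (fun z : 'cV_n => (y^T *m A *m z) 0 0)).
      exact: coord_mulmx_continuous.
    exact: cst_continuous.
  by apply/funext => z; rewrite dotvBr dotvE mulmxA.
- move=> z; have := tangent z.
  have -> : dotv (gradient g x0 + A^T *m y) (z - x0) =
      dotv (gradient g x0) (z - x0) + dotv y (A *m z - b) - dotv y (A *m x0 - b).
    rewrite dotvC dotvDr !(dotvC (z - x0)) -dotv_mulmx mulmxBr !dotvBr; ring.
  lra.
Qed.

Theorem theorem4p1 (R : realType) (m l n : nat)
    (A : 'M[R]_(m, n)) (G : 'M[R]_(l, n)) (L gamma : R) (hgamma : 0 < gamma) :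
  exists2 sigma5 : R, 0 < sigma5 &
    forall (b : 'cV[R]_m) (h : 'cV[R]_l) (g : 'cV[R]_n -> R),
      feasible A G b h !=set0 ->
      (forall x : 'cV[R]_n, differentiable g x) ->
      strongly_convex gamma g ->
      lipschitz_gradient L g ->
      forall y : 'cV[R]_m,
        norm2 (lagrangian_argmin A G b h g y - primal_solution A G b h g) <=
          sigma5 * norm2 (A *m lagrangian_argmin A G b h g y - b).
Proof.
have [sigma sigma0 lipschitz] := solution_lipschitz A G L hgamma.
exists sigma => // b h g ne dg sc lip y.
have [lag prim] := argmins_minimize y hgamma ne dg sc.
exact: lipschitz dg sc lip (lagrangian_minimizer lag) prim.
Qed.
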